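(* Let $\mathbb{F}$ be an algebraically closed field with $\mathrm{Char}(\mathbb{F})\neq 2$ and $\mathrm{Char}(\mathbb{F})\neq 3$. Every non-trivial $2$-dimensional left unital algebra over $\mathbb{F}$ is isomorphic to exactly one of the following pairwise non-isomorphic left unital algebras, given by their matrices of structure constants (MSC): \begin{itemize} \item $A_{1}\left(\alpha_1,\frac{\alpha_1(1-\alpha_1)}{\beta_1}-\frac{1}{2},\frac{\alpha_1(1-\alpha_1)^2}{\beta^2_1}-\frac{1-\alpha_1}{2\beta_1},\beta_1\right)=\left(\begin{array}{cccc}\alpha_1 & \frac{2\alpha_1-2\alpha_1^2-\beta_1}{2\beta_1} & \frac{2\alpha_1-2\alpha_1^2+\beta_1}{2\beta_1} & \frac{2\alpha_1-4\alpha_1^2+2\alpha_1^3-\beta_1+\alpha_1\beta_1}{2\beta_1^2}\\ \beta_1 & -\alpha_1 & 1-\alpha_1 & \frac{-2\alpha_1+2\alpha_1^2+\beta_1}{2\beta_1}\end{array}\right)$, where $\alpha_1,\beta_1\in\mathbb{F}$, $\beta_1\neq 0$; \item $A_{1}\left(1,\alpha_2,\frac{\alpha_2(2\alpha_2+1)}{2},0\right)=\left(\begin{array}{cccc}1 & \alpha_2 & 1+\alpha_2 & \frac{1}{2}(\alpha_2+2\alpha_2^2)\\ 0 & -1 & 0 & -\alpha_2\end{array}\right)$, where $\alpha_2\in\mathbb{F}$; \item $A_{2}(\alpha_1,0,\alpha_1)=\left(\begin{array}{cccc}\alpha_1 & 0 & 0 & 1\\ 0 & \alpha_1 & -\alpha_1+1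 & 0\end{array}\right)$, where $\alpha_1\in\mathbb{F}$, $\alpha_1\neq 0$; \item $A_{4}(\alpha_1,\alpha_1)=\left(\begin{array}{cccc}\alpha_1 & 0 & 0 & 0\\ 0 & \alpha_1 & -\alpha_1+1 & 0\end{array}\right)$, where $\alpha_1\in\mathbb{F}$, $\alpha_1\neq 0$; \item $A_{6}\left(\frac{1}{2},0\right)=\left(\begin{array}{cccc}\frac{1}{2} & 0 & 0 & 1\\ 0 & \frac{1}{2} & -\frac{1}{2} & 0\end{array}\right)$; \item $A_{8}\left(\frac{1}{2}\right)=\left(\begin{array}{cccc}\frac{1}{2} & 0 & 0 & 0\\ 0 & \frac{1}{2} & -\frac{1}{2} & 0\end{array}\right)$. \end{itemize} (Different families, and different parameter values within a family, give non-isomorphic algebras.)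
   Context: An algebra over a field $\mathbb{F}$ is a vector space $\mathbb{A}$ with a bilinear multiplication (not assumed associative, commutative or unital). It is non-trivial if its multiplication is not identically zero. For a $2$-dimensional algebra with basis $(e_1,e_2)$, its matrix of structure constants (MSC) is the $2\times 4$ matrix $A=\left(\begin{array}{cccc}\alpha_1&\alpha_2&\alpha_3&\alpha_4\\ \beta_1&\beta_2&\beta_3&\beta_4\end{array}\right)$ over $\mathbb{F}$ with $e_1e_1=\alpha_1e_1+\beta_1e_2$, $e_1e_2=\alpha_2e_1+\beta_2e_2$, $e_2e_1=\alpha_3e_1+\beta_3e_2$, $e_2e_2=\alpha_4e_1+\beta_4e_2$; equivalently, in coordinate columns, the product of $u$ and $v$ is $A(u\otimes v)$ with $\otimes$ the Kronecker product. An algebra is identified with its MSC. Two algebras with MSCs $A$ and $B$ are isomorphic iff $B=gA(g^{-1})^{\otimes 2}$ for some $g\in GL(2;\mathbb{F})$. An algebra $\mathbb{A}$ is left unital if there is an element $\mathbf{1}_L\in\mathbb{A}$ with $\mathbf{1}_L\cdot\mathbf{u}=\mathbf{u}$ for all $\mathbf{u}\in\mathbb{A}$. The symbols $A_1(\cdot),A_2(\cdot),A_4(\cdot),A_6(\cdot),A_8(\cdot)$ are just names; the algebras meant are those given by the explicit matrices. *)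

(* Defs.v *)
From HB Require Import structures.
From mathcomp Require Import all_boot all_order all_algebra.
From mathcomp Require Import sesquilinear mxtens.

Set Implicit Arguments.
Unset Strict Implicit.
Unset Printing Implicit Defensive.

Import GRing.Theory.
Local Open Scope ring_scope.

(* An algebra is a vector space V together with a bilinear multiplication
   {bilinear V -> V -> V}; the predicates below only need the underlying
   function. *)

Definition nontrivial_alg (F : fieldType) (V : vectType F) (mul : V -> V -> V) :=
  exists u v, mul u v != 0.

Definition left_unital (F : fieldType) (V : vectType F) (mul : V -> V -> V) :=
  exists e, forall u, mul e u = u.

Definition alg_iso (F : fieldType) (V W : vectType F)
    (mulV : V -> V -> V) (mulW : W -> W -> W) :=
  exists2 f : {linear V -> W},
    bijective f & forall u v, f (mulV u v) = mulW (f u) (f v).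

(* The algebra on F^2 with matrix of structure constants A: the product of u
   and v is A (u (x) v). *)
Definition msc_mul (F : fieldType) (A : 'M[F]_(2, 4)) (u v : 'cV[F]_2)
    : 'cV[F]_2 :=
  A *m (u *t v).

Lemma msc_mul_is_bilinear (F : fieldType) (A : 'M[F]_(2, 4)) :
  bilinear_for *:%R *:%R (msc_mul A).
Proof.
split=> [v|u] a x y; rewrite /msc_mul.
- by rewrite -[RHS]/(a *: (A *m (x *t v)) + A *m (y *t v)) scalemxAr -mulmxDr;
    congr (_ *m _); apply/matrixP=> i j; rewrite !mxE mulrDl mulrA.
- by rewrite -[RHS]/(a *: (A *m (u *t x)) + A *m (u *t y)) scalemxAr -mulmxDr;
    congr (_ *m _); apply/matrixP=> i j; rewrite !mxE mulrDr mulrCA.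
Qed.

HB.instance Definition _ (F : fieldType) (A : 'M[F]_(2, 4)) :=
  bilinear_isBilinear.Build F 'cV[F]_2 'cV[F]_2 'cV[F]_2 *:%R *:%R
    (msc_mul A) (msc_mul_is_bilinear A).

(* The columns of A are the products e1 e1, e1 e2, e2 e1, e2 e2, in this
   order: mxtens_index (i, j) has value i * 2 + j. *)
Lemma msc_mul_delta (F : fieldType) (A : 'M[F]_(2, 4)) (i j : 'I_2) :
  msc_mul A (delta_mx i 0) (delta_mx j 0) = col (mxtens_index (i, j)) A.
Proof.
apply/matrixP=> k l; rewrite !mxE (bigD1 (mxtens_index (i, j))) //= big1.
  by rewrite !mxE mxtens_indexK /= !eqxx !ord1 !mulr1 addr0.
move=> m; case: (mxtens_indexP m) => i' j' neq; rewrite !mxE mxtens_indexK /=.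
have [ei|_] := eqVneq i' i; last by rewrite mul0r mulr0.
have [ej|_] := eqVneq j' j; last by rewrite mulr0 mulr0.
by rewrite ei ej eqxx in neq.
Qed.

Definition mx24 (F : fieldType) (r1 r2 : seq F) : 'M[F]_(2, 4) :=
  \matrix_(i, j) (nth [::] [:: r1; r2] i)`_j.

(* Names of the listed algebras, with their parameters. The two families
   called A_1 are separated: A1 a1 b1 is the one with b1 != 0, and A1z a2 is
   the one with alpha_1 = 1 and beta_1 = 0. *)
Inductive lu_name (F : Type) : Type :=
  | A1 of F & F
  | A1z of F
  | A2 of F
  | A4 of F
  | A6
  | A8.
Arguments A6 {F}.
Arguments A8 {F}.

Definition admissible (F : fieldType) (p : lu_name F) : bool :=
  match p with
  | A1 _ b1 => b1 != 0
  | A2 a1 | A4 a1 => a1 != 0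
  | A1z _ | A6 | A8 => true
  end.

Definition lu_msc (F : fieldType) (p : lu_name F) : 'M[F]_(2, 4) :=
  match p with
  | A1 a1 b1 => mx24
      [:: a1;
          (2 * a1 - 2 * a1 ^+ 2 - b1) / (2 * b1);
          (2 * a1 - 2 * a1 ^+ 2 + b1) / (2 * b1);
          (2 * a1 - 4 * a1 ^+ 2 + 2 * a1 ^+ 3 - b1 + a1 * b1) / (2 * b1 ^+ 2)]
      [:: b1; - a1; 1 - a1; (- (2 * a1) + 2 * a1 ^+ 2 + b1) / (2 * b1)]
  | A1z a2 => mx24
      [:: 1; a2; 1 + a2; 2^-1 * (a2 + 2 * a2 ^+ 2)]
      [:: 0; -1; 0; - a2]
  | A2 a1 => mx24
      [:: a1; 0; 0; 1]
      [:: 0; a1; - a1 + 1; 0]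
  | A4 a1 => mx24
      [:: a1; 0; 0; 0]
      [:: 0; a1; - a1 + 1; 0]
  | A6 => mx24
      [:: 2^-1; 0; 0; 1]
      [:: 0; 2^-1; - 2^-1; 0]
  | A8 => mx24
      [:: 2^-1; 0; 0; 0]
      [:: 0; 2^-1; - 2^-1; 0]
  end.

(* Main.v *)
(* Write L_u and R_u for left and right multiplication by u. Every isomorphism
   preserves the linear forms trL : u |-> tr L_u and trR : u |-> tr R_u, and
   trL(e) = 2 is nonzero at a left unit e.

   If trL and trR are linearly independent, the basis dual to (trR, trL) is
   canonical, so the structure constants in it are a complete invariant; these
   are the two families A_1. Otherwise complete e to a basis (e, f) with f in
   the kernel of trL: the dependence forces f e = b f and f f = c e, and scaling
   f by a square root makes c a constant 0 or 1. The coordinates of trL and trR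
   on e recover b, and c = 0 is detected by the square of the kernel vector. *)

Require Import Defs.
From HB Require Import structures.
From mathcomp Require Import all_boot all_order all_algebra.
From mathcomp Require Import sesquilinear mxtens ring.

Set Implicit Arguments.
Unset Strict Implicit.
Unset Printing Implicit Defensive.

Import GRing.Theory.
Local Open Scope ring_scope.

(** * Isomorphisms, coordinates and change of basis *)

Section AlgIso.
Variable F : fieldType.

(** Lets [ring] deduce an equation from a known one: what remains is the polynomial identity
    [z - w = x - y]. *)
Lemma subr_eq_trans (x y z w : F) : x = y -> z - w = x - y -> z = w.
Proof. by move=> ->; rewrite subrr => /eqP; rewrite subr_eq0 => /eqP. Qed.

Lemma alg_iso_sym (V W : vectType F) (mulV : V -> V -> V) (mulW : W -> W -> W) :
  alg_iso mulV mulW -> alg_iso mulW mulV.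
Proof.
case=> f [g fK gK] fM.
have g_lin : linear g by move=> a u v; apply: (can_inj fK); rewrite linearP !gK.
pose gL := GRing.isLinear.Build F W V *:%R g g_lin.
pose h : {linear W -> V} := HB.pack g gL.
exists h => [|u v]; first by exists f.
by apply: (can_inj fK); rewrite fM !gK.
Qed.

Lemma alg_iso_trans (U V W : vectType F) (mulU : U -> U -> U)
    (mulV : V -> V -> V) (mulW : W -> W -> W) :
  alg_iso mulU mulV -> alg_iso mulV mulW -> alg_iso mulU mulW.
Proof.
case=> f f_bij fM [g g_bij gM]; exists (g \o f); first exact: bij_comp.
by move=> u v /=; rewrite fM gM.
Qed.

Lemma msc_mul_mx24 (r s : seq F) (u v : 'cV[F]_2) :
  msc_mul (mx24 r s) u v = \col_i
    [:: r`_0 * (u 0 0 * v 0 0) + r`_1 * (u 0 0 * v 1 0)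
        + r`_2 * (u 1 0 * v 0 0) + r`_3 * (u 1 0 * v 1 0);
        s`_0 * (u 0 0 * v 0 0) + s`_1 * (u 0 0 * v 1 0)
        + s`_2 * (u 1 0 * v 0 0) + s`_3 * (u 1 0 * v 1 0)]`_i.
Proof.
have o0 : 0 = ord0 :> 'I_2 by [].
have o1 : 1 = lift ord0 ord0 :> 'I_2 by apply: val_inj.
apply/matrixP=> i j; rewrite [j]ord1 !mxE.
rewrite (reindex (@mxtens_index 2 2)) /=; last first.
  exists (@mxtens_unindex 2 2) => k _; first exact: mxtens_indexK.
  exact: mxtens_unindexK.
rewrite (eq_bigr (fun p : 'I_2 * 'I_2 =>
  mx24 r s i (mxtens_index (p.1, p.2)) * (u p.1 0 * v p.2 0))); last first.
  by move=> [a b] _; rewrite !mxE !mxtens_indexK /= !ord1.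
rewrite -(pair_bigA _ (fun a b : 'I_2 =>
  mx24 r s i (mxtens_index (a, b)) * (u a 0 * v b 0))) /=.
rewrite !big_ord_recl !big_ord0 !mxE /= /bump /= !addr0 -o1 -o0.
by case: i => [[|[|]]] //= _; rewrite !addrA.
Qed.

(** Vectors written through two coordinates, so that [congr lc] reduces an equality of vectors to
    two scalar identities. *)
Definition lc (V : lmodType F) (p q : V) (x y : F) : V := x *: p + y *: q.

Lemma lcZ (V : lmodType F) (p q : V) k x y :
  k *: lc p q x y = lc p q (k * x) (k * y).
Proof. by rewrite /lc scalerDr !scalerA. Qed.

Lemma lcD (V : lmodType F) (p q : V) x y z w :
  lc p q x y + lc p q z w = lc p q (x + z) (y + w).
Proof. by rewrite /lc !scalerDl addrACA. Qed.

Lemma lc10 (V : lmodType F) (p q : V) : lc p q 1 0 = p.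
Proof. by rewrite /lc scale1r scale0r addr0. Qed.

Lemma lc01 (V : lmodType F) (p q : V) : lc p q 0 1 = q.
Proof. by rewrite /lc scale1r scale0r add0r. Qed.

Lemma mul_lc (V : lmodType F) (mul : {bilinear V -> V -> V}) (p q : V) x y z w :
  mul (lc p q x y) (lc p q z w) = (x * z) *: mul p p + (x * w) *: mul p q
    + (y * z) *: mul q p + (y * w) *: mul q q.
Proof.
rewrite /lc linearDl !linearZl_LR !linearDr !linearZr_LR /=.
by rewrite !scalerDr !scalerA !addrA.
Qed.

(** A spanning pair in dimension 2 is a basis. The coordinate column is sent to the vector it
    describes, and this isomorphism is then reversed. *)
Lemma alg_iso_mx24 (V : vectType F) (mul : {bilinear V -> V -> V}) (p q : V)
    (a1 a2 a3 a4 b1 b2 b3 b4 : F) :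
  \dim {:V} = 2%N -> (forall u, exists x y, u = lc p q x y) ->
  mul p p = lc p q a1 b1 -> mul p q = lc p q a2 b2 ->
  mul q p = lc p q a3 b3 -> mul q q = lc p q a4 b4 ->
  alg_iso mul (msc_mul (mx24 [:: a1; a2; a3; a4] [:: b1; b2; b3; b4])).
Proof.
move=> dimV spanV pp pq qp qq; apply: alg_iso_sym.
pose X := [tuple p; q].
have XB : basis_of fullv X.
  rewrite basisEdim dimV leqnn andbT; apply/subvP=> u _.
  have [x [y ->]] := spanV u.
  by rewrite memvD // memvZ // memv_span // !inE eqxx ?orbT.
pose g (c : 'cV[F]_2) := \sum_i c i 0 *: X`_i.
have gE c : g c = lc p q (c 0 0) (c 1 0).
  rewrite /g !big_ord_recl big_ord0 addr0 /=.
  by congr (_ + c _ _ *: _); apply: val_inj.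
have g_lin : linear g.
  by move=> k u v; rewrite !gE !mxE lcZ lcD.
pose gL := GRing.isLinear.Build F 'cV[F]_2 V *:%R g g_lin.
pose h : {linear 'cV[F]_2 -> V} := HB.pack g gL.
exists h => [|u v].
  exists (fun v => \col_i coord X i v) => [c|v] /=.
    by apply/colP=> i; rewrite mxE coord_sum_free // (basis_free XB).
  rewrite [RHS](coord_basis XB (memvf v)); apply: eq_bigr => i _.
  by rewrite mxE.
rewrite [LHS]gE [h u]gE [h v]gE mul_lc msc_mul_mx24 !mxE /=.
rewrite pp pq qp qq !lcZ !lcD.
by congr lc; ring.
Qed.

Lemma lc_lc (V : lmodType F) (p q : V) x y z w s t :
  lc (lc p q x y) (lc p q z w) s t = lc p q (s * x + t * z) (s * y + t * w).
Proof. by rewrite {1}/lc !lcZ lcD. Qed.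

(** * Normal forms of left unital algebras *)

Lemma span2_exists (V : vectType F) (e : V) :
  \dim {:V} = 2%N -> e != 0 -> exists f, forall u, exists x y, u = lc e f x y.
Proof.
move=> dimV e_neq0.
have [f _ fNe] : exists2 f, f \in {:V}%VS & f \notin <[e]>%VS.
  apply/subvPn; apply/negP=> /dimvS; rewrite dimV.
  by rewrite dim_vline e_neq0.
exists f => u.
have fe_basis : basis_of fullv [:: f; e].
  by rewrite basisEfree subvf dimV free_cons span_seq1 fNe seq1_free e_neq0.
have := memvf u; rewrite -(span_basis fe_basis) span_cons span_seq1.
case/memv_addP=> _ /vlineP[y ->] [_ /vlineP[x ->] ->].
by exists x, y; rewrite addrC.
Qed.

(* The opposite coefficients a and - a express that f is in the kernel of
   u |-> tr L_u; u |-> tr R_u vanishes at f exactly when a = 0. *)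
Lemma left_unital_basis (V : vectType F) (mul : {bilinear V -> V -> V}) :
  2%:R != 0 :> F -> \dim {:V} = 2%N -> nontrivial_alg mul -> left_unital mul ->
  exists e f a b c,
    [/\ forall u, exists x y, u = lc e f x y, forall u, mul e u = u,
        mul f e = lc e f a b & mul f f = lc e f c (- a)].
Proof.
move=> two_neq0 dimV [u0 [v0 uv_neq0]] [e eM].
have e_neq0 : e != 0.
  apply: contraNneq uv_neq0 => e0; rewrite -(eM v0) e0 linear0l.
  by rewrite linear0r.
have [f0 span_f0] := span2_exists dimV e_neq0.
have [a0 [b f0e]] := span_f0 (mul f0 e).
have [c [d f0f0]] := span_f0 (mul f0 f0).
(* Since tr L_f0 = [a0 + d] and tr L_e = 2, subtracting [s *: e] from [f0] makes the trace of left
   multiplication vanish. *)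
pose s := (a0 + d) / 2; pose f := lc e f0 (- s) 1.
have f0E x y : lc e f0 x y = lc e f (x + s * y) y.
  by rewrite -{2}[e](lc10 e f0) lc_lc; congr lc; ring.
have ef0M : mul e f0 = lc e f0 0 1 by rewrite eM lc01.
have eeM : mul e e = lc e f0 1 0 by rewrite eM lc10.
exists e, f, (a0 - s + b * s), b, (c - s * a0 + s ^+ 2 + s * (d - s * b - s)).
split=> [u||| ] //.
- by have [x [y ->]] := span_f0 u; exists (x + s * y), y; rewrite f0E.
- rewrite -{1}(lc10 e f0) /f mul_lc eeM ef0M f0e f0f0 !lcZ !lcD f0E.
  by congr lc; ring.
- rewrite /f mul_lc eeM ef0M f0e f0f0 !lcZ !lcD f0E.
  congr lc; first by ring.
  by rewrite /s; field.
Qed.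

(** The common shape of [A2], [A4], [A6] and [A8]; for [l != 0] the first basis vector is [l] times
    a left unit. *)
Definition diag_msc (l r c : F) := mx24 [:: l; 0; 0; c] [:: 0; l; r; 0].

(** The basis is [(l *: e, t *: f)]: the square of [t *: f] is [t ^+ 2 * c] times [e], that is [d]
    times [l *: e]. *)
Lemma alg_iso_diag_msc (V : vectType F) (mul : {bilinear V -> V -> V})
    (e f : V) (b c l t d : F) :
  \dim {:V} = 2%N -> (forall u, exists x y, u = lc e f x y) ->
  (forall u, mul e u = u) -> mul f e = b *: f -> mul f f = c *: e ->
  l != 0 -> t != 0 -> t ^+ 2 * c = d * l ->
  alg_iso mul (msc_mul (diag_msc l (l * b) d)).
Proof.
move=> dimV spanV eM fe ff l_neq0 t_neq0 tcE.
have ee' : mul e e = lc e f 1 0 by rewrite eM lc10.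
have ef' : mul e f = lc e f 0 1 by rewrite eM lc01.
have fe' : mul f e = lc e f 0 b by rewrite fe /lc scale0r add0r.
have ff' : mul f f = lc e f c 0 by rewrite ff /lc scale0r addr0.
apply: (@alg_iso_mx24 _ _ (lc e f l 0) (lc e f 0 t)) => // [u||||].
- have [x [y ->]] := spanV u; exists (x / l), (y / t).
  by rewrite lc_lc; congr lc; field; rewrite ?l_neq0 ?t_neq0.
all: rewrite mul_lc ee' ef' fe' ff' lc_lc !lcZ !lcD; congr lc; try ring.
by rewrite -tcE; ring.
Qed.

Lemma left_unital_classified (V : vectType F) (mul : {bilinear V -> V -> V}) :
  2%:R != 0 :> F -> (forall x : F, exists y, y ^+ 2 = x) ->
  \dim {:V} = 2%N -> nontrivial_alg mul -> left_unital mul ->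
  exists p : lu_name F, admissible p /\ alg_iso mul (msc_mul (lu_msc p)).
Proof.
move=> two_neq0 sqrtF dimV mulN0 mulL.
have [e [f [a [b [c [spanV eM fe ff]]]]]] :=
  left_unital_basis two_neq0 dimV mulN0 mulL.
(* Here trL e = 2, trL f = 0, trR e = 1 + b and trR f = -a, so the two forms are dependent exactly
   when [a = 0]. *)
have [a0|a_neq0] := eqVneq a 0.
  (* The two disjunctions say that [c] and [d] vanish together; then [t] is a square root of
     [d * l / c], or 1 if both are zero. *)
  have diag l d : l != 0 -> d != 0 \/ c = 0 -> d = 0 \/ c <> 0 ->
      alg_iso mul (msc_mul (diag_msc l (l * b) d)).
    move=> l_neq0 dc cd.
    have [t t_neq0 tcE] : exists2 t, t != 0 & t ^+ 2 * c = d * l.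
      have [c0|c_neq0] := eqVneq c 0.
        exists 1; rewrite ?oner_neq0 // c0 mulr0.
        by case: cd => [->|]; rewrite ?mul0r.
      have [t tE] := sqrtF (d * l / c); exists t; last by rewrite tE divfK.
      case: dc => [d_neq0|c0]; last by rewrite c0 eqxx in c_neq0.
      have : t ^+ 2 != 0 by rewrite tE !mulf_neq0 // invr_neq0.
      by rewrite expf_eq0.
    apply: (alg_iso_diag_msc (e := e) (f := f) (c := c) (t := t)) => //.
      by rewrite fe a0 /lc scale0r add0r.
    by rewrite ff a0 oppr0 /lc scale0r addr0.
  (* The vector [l *: e] is normalized by trR = 1, giving [l = (1 + b)^-1]. When trR e = 0 it is
     normalized by trL = 1, giving [l = 2^-1]. *)
  have [b1|b_neq] := eqVneq (1 + b) 0.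
    have {}b1 : b = -1 by apply/eqP; rewrite -subr_eq0 opprK addrC b1.
    have half_neq0 : 2^-1 != 0 :> F by rewrite invr_neq0.
    have [c0|/eqP c_neq0] := eqVneq c 0.
      exists A8; split=> //.
      have := diag _ 0 half_neq0 (or_intror c0) (or_introl (erefl _)).
      by rewrite b1 mulrN1.
    exists A6; split=> //.
    have := diag _ 1 half_neq0 (or_introl (oner_neq0 _)) (or_intror c_neq0).
    by rewrite b1 mulrN1.
  have l_neq0 : (1 + b)^-1 != 0 by rewrite invr_neq0.
  have rE : (1 + b)^-1 * b = - (1 + b)^-1 + 1 by field.
  have [c0|/eqP c_neq0] := eqVneq c 0.
    exists (A4 (1 + b)^-1); split=> //=; rewrite -rE.
    exact: diag (or_intror c0) (or_introl (erefl _)).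
  exists (A2 (1 + b)^-1); split=> //=; rewrite -rE.
  exact: diag (or_introl (oner_neq0 _)) (or_intror c_neq0).
(* The basis dual to (trR, trL). *)
pose e1 := lc e f 0 (- a^-1).
pose e2 := lc e f 2^-1 ((1 + b) / (2 * a)).
have span12 u : exists x y, u = lc e1 e2 x y.
  (* By duality the coordinates of [u] are trR u and trL u. *)
  have [x [y ->]] := spanV u; exists (x * (1 + b) - y * a), (2 * x).
  by rewrite /e1 /e2 lc_lc; congr lc; field; rewrite ?two_neq0 ?a_neq0.
have ee' : mul e e = lc e f 1 0 by rewrite eM lc10.
have ef' : mul e f = lc e f 0 1 by rewrite eM lc01.
(* In the dual basis e = (1 + b) e1 + 2 e2 and e1 e1 = (c / a^2) e + e1. Hence beta_1 = 2c / a^2,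
   which is zero exactly when [c] is, and alpha_1 = (1 + b) c / a^2 + 1. *)
have [c0|c_neq0] := eqVneq c 0.
  exists (A1z (- (2 + b) / 2)); split=> //.
  apply: (alg_iso_mx24 dimV span12); rewrite /e1 /e2;
  rewrite !mul_lc ee' ef' fe ff !lc_lc !lcZ !lcD c0; congr lc;
  by field; rewrite ?two_neq0 ?a_neq0.
have four_neq0 : 4 != 0 :> F by rewrite (natrM _ 2 2) mulf_neq0.
exists (A1 (c / a ^+ 2 * (1 + b) + 1) (2 * c / a ^+ 2)); split=> /=.
  by rewrite !mulf_neq0 // invr_neq0 // expf_neq0.
apply: (alg_iso_mx24 dimV span12); rewrite /e1 /e2;
rewrite !mul_lc ee' ef' fe ff !lc_lc !lcZ !lcD; congr lc;
by field; rewrite ?two_neq0 ?four_neq0 ?a_neq0 ?c_neq0.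
Qed.

(** * Trace forms as isomorphism invariants *)

Lemma linear_colE m n (f : {linear 'cV[F]_n -> 'cV[F]_m}) v :
  f v = (\matrix_(i, j) f (delta_mx j 0) i 0) *m v.
Proof.
rewrite {1}[v]matrix_sum_delta linear_sum; apply/colP=> i.
rewrite summxE !mxE; apply: eq_bigr => j _.
by rewrite big_ord1 linearZ /= !mxE mulrC.
Qed.

Lemma linear_bij_unitmx n (f : {linear 'cV[F]_n -> 'cV[F]_n}) :
  bijective f -> (\matrix_(i, j) f (delta_mx j 0) i 0) \in unitmx.
Proof.
set G := (X in X \in _); case=> g _ gK.
suff : G *m (\matrix_(i, j) g (delta_mx j 0) i 0) = 1%:M by case/mulmx1_unit.
apply/matrixP=> i j; have := gK (delta_mx j 0); rewrite (linear_colE f) -/G.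
move/colP/(_ i); rewrite !mxE eqxx andbT => <-.
by apply: eq_bigr => k _; rewrite [in LHS]mxE.
Qed.

(** Both sums are traces, and the matrix of the bijection [f] conjugates the matrix of [g] to that
    of [h]. *)
Lemma mxtrace_linear_conj n (f g h : {linear 'cV[F]_n -> 'cV[F]_n}) :
  bijective f -> (forall v, f (g v) = h (f v)) ->
  \sum_i g (delta_mx i 0) i 0 = \sum_i h (delta_mx i 0) i 0.
Proof.
move=> /linear_bij_unitmx; set G := (X in X \in _) => Gu fgh.
have trE (k : {linear 'cV[F]_n -> 'cV[F]_n}) :
    \sum_i k (delta_mx i 0) i 0 = \tr (\matrix_(i, j) k (delta_mx j 0) i 0).
  by apply: eq_bigr => i _; rewrite mxE.
rewrite !trE; set P := (X in \tr X = _); set Q := (X in _ = \tr X).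
have GP : G *m P = Q *m G.
  apply/matrixP=> i j; have := fgh (delta_mx j 0).
  rewrite (linear_colE g) (linear_colE h) !(linear_colE f) -/G -/P -/Q.
  by rewrite !mulmxA -!colE => /colP/(_ i); rewrite !mxE.
by rewrite -[P](mulKmx Gu) GP mxtrace_mulC mulmxK.
Qed.

Section IsoTraces.
Variables (a1 a2 a3 a4 b1 b2 b3 b4 a1' a2' a3' a4' b1' b2' b3' b4' : F).
Let bil (C : 'M[F]_(2, 4)) :
  {bilinear 'cV[F]_2 -> 'cV[F]_2 -> 'cV[F]_2} := msc_mul C.
Let A := mx24 [:: a1; a2; a3; a4] [:: b1; b2; b3; b4].
Let B := mx24 [:: a1'; a2'; a3'; a4'] [:: b1'; b2'; b3'; b4'].
Variable f : {linear 'cV[F]_2 -> 'cV[F]_2}.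
Hypothesis f_bij : bijective f.
Hypothesis fM : forall u v, f (msc_mul A u v) = msc_mul B (f u) (f v).

(** Invariance of trL: [f] conjugates left multiplication by [u] to left multiplication by [f u].
    The next lemma is the same for trR. *)
Lemma iso_trace_left (u : 'cV[F]_2) : (a1 + b2) * u 0 0 + (a3 + b4) * u 1 0
  = (a1' + b2') * f u 0 0 + (a3' + b4') * f u 1 0.
Proof.
have := mxtrace_linear_conj (g := bil A u) (h := bil B (f u)) f_bij (fM u).
by rewrite !big_ord_recl !big_ord0 /= !msc_mul_mx24 !mxE /= => E;
  apply: (subr_eq_trans E); ring.
Qed.

Lemma iso_trace_right (u : 'cV[F]_2) : (a1 + b3) * u 0 0 + (a2 + b4) * u 1 0
  = (a1' + b3') * f u 0 0 + (a2' + b4') * f u 1 0.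
Proof.
have := mxtrace_linear_conj (g := applyr (bil A) u)
  (h := applyr (bil B) (f u)) f_bij (fM^~ u).
by rewrite !big_ord_recl !big_ord0 /= !msc_mul_mx24 !mxE /= => E;
  apply: (subr_eq_trans E); ring.
Qed.
End IsoTraces.

(** * Isomorphisms between the listed algebras *)

Lemma msc_mul_inj (A B : 'M[F]_(2, 4)) : msc_mul A =2 msc_mul B -> A = B.
Proof.
move=> AB; apply/matrixP=> i k; case: (@mxtens_indexP 2 2 k) => a b.
have := AB (delta_mx a 0) (delta_mx b 0).
by rewrite !msc_mul_delta => /colP/(_ i); rewrite !mxE.
Qed.

Lemma colP2 (u v : 'cV[F]_2) : u 0 0 = v 0 0 -> u 1 0 = v 1 0 -> u = v.
Proof.
move=> uv0 uv1; apply/colP=> -[[|[|]]] // lti.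
  by have -> : Ordinal lti = 0 by apply: val_inj.
by have -> : Ordinal lti = 1 by apply: val_inj.
Qed.

Lemma linear_inj_delta_neq0 (f : {linear 'cV[F]_2 -> 'cV[F]_2}) i :
  injective f -> f (delta_mx i 0) != 0.
Proof.
move=> f_inj; apply/eqP; rewrite -(linear0 f) => /f_inj/colP/(_ i)/eqP.
by rewrite !mxE !eqxx oner_eq0.
Qed.

(** In both algebras the coordinates of a vector are its trR and trL, so an isomorphism preserves
    coordinates and is the identity. *)
Lemma iso_dual_msc (a1 a2 a4 b1 a1' a2' a4' b1' : F) :
  let A := mx24 [:: a1; a2; 1 + a2; a4] [:: b1; - a1; 1 - a1; - a2] in
  let B := mx24 [:: a1'; a2'; 1 + a2'; a4'] [:: b1'; - a1'; 1 - a1'; - a2'] in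
  alg_iso (msc_mul A) (msc_mul B) -> A = B.
Proof.
move=> A B [f f_bij fM]; apply: msc_mul_inj => u v.
have f_id w : f w = w.
  have L := iso_trace_left f_bij fM w; have R := iso_trace_right f_bij fM w.
  apply: colP2; first by apply: (subr_eq_trans (esym R)); ring.
  by apply: (subr_eq_trans (esym L)); ring.
by rewrite -[u in RHS]f_id -[v in RHS]f_id -fM f_id.
Qed.

(** In [diag_msc] both trace forms vanish on the second basis vector; in the other algebra they are
    the coordinates, so its image would be 0. *)
Lemma iso_dual_diag (a1 a2 a4 b1 l r c : F) :
  ~ alg_iso (msc_mul (mx24 [:: a1; a2; 1 + a2; a4] [:: b1; - a1; 1 - a1; - a2]))
            (msc_mul (diag_msc l r c)).
Proof.
move=> /alg_iso_sym[f f_bij fM].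
have L := iso_trace_left f_bij fM (delta_mx 1 0).
have R := iso_trace_right f_bij fM (delta_mx 1 0).
move/eqP: (linear_inj_delta_neq0 1 (bij_inj f_bij)); apply.
rewrite !mxE /= in L R; apply: colP2; rewrite mxE.
  by apply: (subr_eq_trans (esym R)); ring.
by apply: (subr_eq_trans (esym L)); ring.
Qed.

(** The factor [k] is the first coordinate of the image of the first basis vector; trL gives the
    relation on [l], and trR then the one on [r]. *)
Lemma iso_diag_msc (l r c l' r' c' : F) :
  2%:R != 0 :> F -> l != 0 -> l' != 0 ->
  alg_iso (msc_mul (diag_msc l r c)) (msc_mul (diag_msc l' r' c')) ->
  exists2 k, [/\ k != 0, l = l' * k & r = r' * k] & (c == 0) = (c' == 0).
Proof.
move=> two_neq0 l_neq0 l'_neq0 [f f_bij fM].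
have L := iso_trace_left f_bij fM (delta_mx 0 0).
have R := iso_trace_right f_bij fM (delta_mx 0 0).
have L1 := iso_trace_left f_bij fM (delta_mx 1 0).
rewrite !mxE /= in L R L1.
set k := f _ 0 0 in L R.
have lE : l = l' * k.
  by apply: (mulfI two_neq0); apply: (subr_eq_trans L); ring.
have rE : r = r' * k.
  by apply: (addrI l); rewrite {2}lE; apply: (subr_eq_trans R); ring.
(* The second basis vector lies in the kernel of trL, which is spanned by the second basis vector of
   the target. *)
have f1_0 : f (delta_mx 1 0) 0 0 = 0.
  apply: (mulfI two_neq0); apply: (mulfI l'_neq0).
  by apply: (subr_eq_trans (esym L1)); ring.
have k_neq0 : k != 0 by apply: contraNneq l_neq0 => k0; rewrite lE k0 mulr0.
exists k => //.
have f1_1 : f (delta_mx 1 0) 1 0 != 0.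
  apply: contraNneq (linear_inj_delta_neq0 1 (bij_inj f_bij)) => f1_1.
  by apply/eqP; apply: colP2; rewrite mxE.
(* Comparing squares of the kernel vectors gives [c * k] as [c'] times a nonzero square. *)
have := congr1 (fun w : 'cV[F]_2 => w 0 0) (fM (delta_mx 1 0) (delta_mx 1 0)).
rewrite (_ : msc_mul _ _ _ = c *: delta_mx 0 0); last first.
  by rewrite msc_mul_mx24; apply: colP2; rewrite !mxE /=; ring.
rewrite linearZ msc_mul_mx24 !mxE /= f1_0 -/k => E.
have {}E : c * k = c' * (f (delta_mx 1 0) 1 0 * f (delta_mx 1 0) 1 0)
  by apply: (subr_eq_trans E); ring.
have : (c * k == 0) = (c' * (f (delta_mx 1 0) 1 0 * f (delta_mx 1 0) 1 0) == 0).
  by rewrite E.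
by rewrite !mulf_eq0 (negPf k_neq0) (negPf f1_1) !orbF.
Qed.

(* The algebras for which the standard basis is dual to (trR, trL). *)
Definition is_dual (p : lu_name F) : bool :=
  match p with A1 _ _ | A1z _ => true | _ => false end.

Lemma lu_msc_dual (p : lu_name F) :
  2%:R != 0 :> F -> admissible p -> is_dual p ->
  exists a1 a2 a4 b1,
    lu_msc p = mx24 [:: a1; a2; 1 + a2; a4] [:: b1; - a1; 1 - a1; - a2].
Proof.
move=> two_neq0; case: p => // [a b /= b_neq0|a] _.
  exists a, ((2 * a - 2 * a ^+ 2 - b) / (2 * b)).
  exists ((2 * a - 4 * a ^+ 2 + 2 * a ^+ 3 - b + a * b) / (2 * b ^+ 2)), b.
  congr (mx24 [:: _; _; _; _] [:: _; _; _; _]);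
  by field; rewrite two_neq0 b_neq0.
exists 1, a, (2^-1 * (a + 2 * a ^+ 2)), 0.
by congr (mx24 _ [:: _; _; _; _]); rewrite subrr.
Qed.

Lemma lu_msc_dual_inj (p q : lu_name F) :
  admissible p -> admissible q -> is_dual p -> is_dual q ->
  lu_msc p = lu_msc q -> p = q.
Proof.
move=> pP qP pD qD /matrixP pq.
(* The entries alpha_1, alpha_2 and beta_1 suffice: beta_1 separates the two families, and the
   parameters are among the three. *)
have := pq 0 (inord 0); have := pq 0 (inord 1); have := pq 1 (inord 0).
case: p pP pD {pq} => // [a b|a] /= b0 _;
case: q qP qD => // [a' b'|a'] /= b0' _;
  rewrite !mxE !inordK //= => E1 E2 E3.
- by rewrite E1 E3.
- by rewrite E1 eqxx in b0.
- by rewrite -E1 eqxx in b0'.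
- by rewrite E2.
Qed.

(* Meaningful only when ~~ is_dual p. *)
Definition lu_diag (p : lu_name F) : F * F * F :=
  match p with
  | A2 a => (a, - a + 1, 1)
  | A4 a => (a, - a + 1, 0)
  | A6 => (2^-1, - 2^-1, 1)
  | A8 => (2^-1, - 2^-1, 0)
  | _ => (0, 0, 0)
  end.

Lemma lu_msc_diag (p : lu_name F) : ~~ is_dual p ->
  lu_msc p = diag_msc (lu_diag p).1.1 (lu_diag p).1.2 (lu_diag p).2.
Proof. by case: p. Qed.

(** Adding the two equations compares trR of the first basis vectors, which is 1 for [A2] and [A4]
    and 0 for [A6] and [A8]. So mixed cases are impossible, and in the first two families [k = 1];
    the last component separates the rest. *)
Lemma lu_diag_inj (p q : lu_name F) k :
  k != 0 -> ~~ is_dual p -> ~~ is_dual q ->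
  (lu_diag p).1.1 = (lu_diag q).1.1 * k ->
  (lu_diag p).1.2 = (lu_diag q).1.2 * k ->
  ((lu_diag p).2 == 0) = ((lu_diag q).2 == 0) -> p = q.
Proof.
move=> k_neq0 pD qD.
case: p pD => // [a|a||] _; case: q qD => [? ?|?|a'|a'||] // _ /= E1 E2;
  rewrite ?eqxx ?oner_eq0 // => _; have := congr2 +%R E1 E2; rewrite -mulrDl.
all: rewrite ?addrA ?(subrr, add0r) ?(mul0r, mul1r).
all: move=> kE; first [by rewrite E1 -kE mulr1
  | by move/eqP: kE; rewrite oner_eq0 | by rewrite -kE eqxx in k_neq0].
Qed.

Lemma lu_msc_iso_inj (p q : lu_name F) :
  2%:R != 0 :> F -> admissible p -> admissible q ->
  alg_iso (msc_mul (lu_msc p)) (msc_mul (lu_msc q)) -> p = q.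
Proof.
move=> two_neq0 pP qP pq.
have [pD|pD] := boolP (is_dual p); have [qD|qD] := boolP (is_dual q).
- apply: lu_msc_dual_inj => //.
  have [a1 [a2 [a4 [b1 pE]]]] := lu_msc_dual two_neq0 pP pD.
  have [a1' [a2' [a4' [b1' qE]]]] := lu_msc_dual two_neq0 qP qD.
  by rewrite pE qE in pq *; apply: iso_dual_msc pq.
- have [a1 [a2 [a4 [b1 pE]]]] := lu_msc_dual two_neq0 pP pD.
  by rewrite pE (lu_msc_diag qD) in pq; have := iso_dual_diag pq.
- have [a1 [a2 [a4 [b1 qE]]]] := lu_msc_dual two_neq0 qP qD.
  move: pq => /alg_iso_sym pq.
  by rewrite qE (lu_msc_diag pD) in pq; have := iso_dual_diag pq.
have diag_neq0 s : admissible s -> ~~ is_dual s -> (lu_diag s).1.1 != 0.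
  by case: s => //= *; rewrite invr_neq0.
rewrite (lu_msc_diag pD) (lu_msc_diag qD) in pq.
have [k [k_neq0 E1 E2] E3] :=
  iso_diag_msc two_neq0 (diag_neq0 _ pP pD) (diag_neq0 _ qP qD) pq.
exact: lu_diag_inj k_neq0 pD qD E1 E2 E3.
Qed.

(** * Left units of the listed algebras, and the classification *)

Lemma lu_msc_left_unital (p : lu_name F) :
  2%:R != 0 :> F -> admissible p -> left_unital (msc_mul (lu_msc p)).
Proof.
move=> two_neq0 pP.
pose vec x y : 'cV[F]_2 := \col_i [:: x; y]`_i.
have unit x y : (forall u, msc_mul (lu_msc p) (vec x y) u = u) ->
  left_unital (msc_mul (lu_msc p)) by exists (vec x y).
case: p pP unit => [a b /= b_neq0|a _|a /= a_neq0|a /= a_neq0|_|_] unit.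
(* For the dual families the left unit e has coordinates (trR e, trL e), with trL e = 2; in the
   others it is a multiple of the first basis vector. *)
- apply: (unit (- 2 * (1 - a) / b) 2) => u.
  rewrite msc_mul_mx24; apply: colP2; rewrite !mxE /=; field;
  by rewrite ?two_neq0 ?b_neq0.
- apply: (unit (- 1 - 2 * a) 2) => u.
  by rewrite msc_mul_mx24; apply: colP2; rewrite !mxE /=; field.
- apply: (unit a^-1 0) => u.
  by rewrite msc_mul_mx24; apply: colP2; rewrite !mxE /=; field.
- apply: (unit a^-1 0) => u.
  by rewrite msc_mul_mx24; apply: colP2; rewrite !mxE /=; field.
- apply: (unit 2 0) => u.
  by rewrite msc_mul_mx24; apply: colP2; rewrite !mxE /=; field.
- apply: (unit 2 0) => u.
  by rewrite msc_mul_mx24; apply: colP2; rewrite !mxE /=; field.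
Qed.

End AlgIso.

Theorem theorem3p1 (F : closedFieldType)
    (char2 : 2%N \notin [pchar F]) (char3 : 3%N \notin [pchar F]) :
  [/\ forall p : lu_name F, admissible p -> left_unital (msc_mul (lu_msc p)),
      forall p q : lu_name F, admissible p -> admissible q ->
        alg_iso (msc_mul (lu_msc p)) (msc_mul (lu_msc q)) -> p = q
    & forall (V : vectType F) (mul : {bilinear V -> V -> V}),
        \dim {:V} = 2%N -> nontrivial_alg mul -> left_unital mul ->
        exists! p : lu_name F,
          admissible p /\ alg_iso mul (msc_mul (lu_msc p))].
Proof.
have two_neq0 : 2%:R != 0 :> F by move: char2; rewrite inE.
split=> [p|p q|V mul dimV mulN0 mulL].
- exact: lu_msc_left_unital.
- exact: lu_msc_iso_inj.
have sqrtF (x : F) : exists y, y ^+ 2 = x.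
  (* The monic equation solved is [y ^+ 2 = x + 0 * y]. *)
  have [y yE] :=
    solve_monicpoly (n := 2) (fun i => if i is 0%N then x else 0) isT.
  by exists y; rewrite yE !big_ord_recl big_ord0 /= expr0 mulr1 mul0r !addr0.
have [p [pP mulp]] := left_unital_classified two_neq0 sqrtF dimV mulN0 mulL.
exists p; split=> // q [qP mulq]; apply: lu_msc_iso_inj => //.
exact: alg_iso_trans (alg_iso_sym mulp) mulq.
Qed.
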